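(* (i) Let $(E,\mathcal E)$ be a measurable space and let $X$ be a nonlinear Markov chain on $(E,\mathcal E)$ with transition probabilities $P_\mu(x,B)$. Assume that for some $\alpha>0$ $$\sup_{\mu,\nu\in\mathcal P(E)} d_{TV}\bigl(P_\mu(x,\cdot),P_\nu(y,\cdot)\bigr)\le 2(1-\alpha)\quad\text{for all }x,y\in E, \qquad (A)$$ and that there exists $\lambda\in[0,\alpha]$ such that $$d_{TV}\bigl(P_\mu(x,\cdot),P_\nu(x,\cdot)\bigr)\le \lambda\, d_{TV}(\mu,\nu)\quad\text{for all }x\in E,\ \mu,\nu\in\mathcal P(E). \qquad (B)$$ Then $X$ has a unique invariant measure $\pi$. Moreover, if $\lambda<\alpha$, then for every $\mu\in\mathcal P(E)$ $$d_{TV}(\mu_n,\pi)\le 2\bigl(1-(\alpha-\lambda)\bigr)^n,\quad n\in\mathbb Z_+,$$ and if $\lambda=\alpha$, then for every $\mu\in\mathcal P(E)$ $$d_{TV}(\mu_n,\pi)\le \frac{2}{\lambda n},\quad n\in\mathbb Z_+$$ (with the right-hand side read as $+\infty$ for $n=0$). Here $\mu_n$ is the law at time $n$ of the chain started from the initial distribution $\mu$. (ii) The restriction $\lambda\in[0,\alpha]$ is optimal in the following sense. For every pair $(\alpha,\lambda)$ with $0<\alpha<\lambda\le 1$ there exist nonlinear Markov chains $X=(X_n)_{n\in\mathbb Z_+}$, $Y=(Y_n)_{n\in\mathbb Z_+}$, $Z=(Z_n)_{n\in\mathbb Z_+}$ (each on some measurable state space), each satisfying (A) and (B) with these $\alpha$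 and $\lambda$, such that: $X$ has more than one stationary measure; $Y$ has no stationary measure; and $Z$ has a stationary measure $\pi$ and there is a probability measure $\mu$ on the state space of $Z$ such that $d_{TV}(\mathrm{Law}(Z_n^\mu),\pi)\not\to 0$ as $n\to\infty$, where $Z^\mu$ denotes the chain $Z$ with initial distribution $\mu$.
   Context: For a measurable space $(E,\mathcal E)$, $\mathcal P(E)$ denotes the set of all probability measures on it. For $\mu,\nu\in\mathcal P(E)$ the total variation distance is normalized as $d_{TV}(\mu,\nu)=2\sup_{A\in\mathcal E}|\mu(A)-\nu(A)|$. A nonlinear Markov chain on $(E,\mathcal E)$ is given by a family of transition kernels $P_\mu(x,B)$, $\mu\in\mathcal P(E)$, $x\in E$, $B\in\mathcal E$ (for each $\mu$, $P_\mu$ is a Markov transition kernel on $(E,\mathcal E)$). The chain $X^\mu=(X_n^\mu)_{n\in\mathbb Z_+}$ with initial distribution $\mathrm{Law}(X_0^\mu)=\mu$ has transition probabilities $\mathsf P(X^\mu_{n+1}\in B\mid X^\mu_n=x)=P_{\mu_n}(x,B)$, where $\mu_n:=\mathrm{Law}(X_n^\mu)$. Thus $\mu_0=\mu$ and $\mu_{n+1}=P_{\mu_n}\mu_n$, where for a kernel $Q$ and a measure $\nu$ one writes $Q\nu(B)=\int_E Q(t,B)\,\nu(dt)$. A measure $\pi\in\mathcal P(E)$ is invariant (stationary) for the chain if $P_\pi\pi=\pi$. *)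

(* Defs.v *)
From HB Require Import structures.
From mathcomp Require Import all_boot all_order all_algebra.
From mathcomp Require Import all_classical all_reals all_analysis.

Set Implicit Arguments.
Unset Strict Implicit.
Unset Printing Implicit Defensive.

Import Order.TTheory GRing.Theory Num.Theory.
Import numFieldNormedType.Exports.

Local Open Scope classical_set_scope.
Local Open Scope ring_scope.
Local Open Scope ereal_scope.

(* A measure in MathComp-Analysis is a total function on [set E], with
   unconstrained values on non-measurable sets.  Equality of two elements of
   P(E) in the usual sense is therefore agreement on measurable sets. *)
Definition eq_law d (E : measurableType d) (R : realType)
    (mu nu : {measure set E -> \bar R}) : Prop :=
  forall A : set E, measurable A -> mu A = nu A.

Definition d_TV d (E : measurableType d) (R : realType)
    (mu nu : {measure set E -> \bar R}) : \bar R :=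
  2%:E * ereal_sup [set `|mu A - nu A| | A in [set A : set E | measurable A]].

Section kernel_action.
Context d (E : measurableType d) (R : realType).
Variables (Q : R.-pker E ~> E) (nu : probability E R).

Definition kact (B : set E) : \bar R := \int[nu]_t Q t B.

Let kact0 : kact set0 = 0.
Proof.
by rewrite /kact (eq_integral (cst 0)) ?integral0// => t _; rewrite measure0.
Qed.

Let kact_ge0 B : 0 <= kact B. Proof. exact: integral_ge0. Qed.

Let kact_sigma_additive : semi_sigma_additive kact.
Proof.
move=> F mF tF mUF; rewrite [X in _ --> X](_ : _ =
  \int[nu]_t (\sum_(n <oo) Q t (F n))); last first.
  apply: eq_integral => t _.
  by apply/esym/cvg_lim => //; exact/measure_semi_sigma_additive.
apply/cvg_closeP; split.
  by apply: is_cvg_nneseries => n _ _; exact: integral_ge0.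
rewrite closeE// integral_nneseries// => n.
exact: measurable_kernel.
Qed.

HB.instance Definition _ :=
  isMeasure.Build _ _ _ kact kact0 kact_ge0 kact_sigma_additive.

Let kact_setT : kact [set: E] = 1.
Proof.
rewrite /kact (eq_integral (cst 1)) => [|t _]; last by rewrite prob_kernel.
by rewrite integral_cst// mul1e; exact: probability_setT.
Qed.

HB.instance Definition _ := Measure_isProbability.Build _ _ _ kact kact_setT.

Definition kernel_act : probability E R := kact.

End kernel_action.

(* [nlmc_ext] says that P_mu(x, B), for B measurable, depends on mu only
   through its restriction to the sigma-algebra, i.e., that mu |-> P_mu is a
   well-defined map on P(E); see [eq_law]. *)
Record nonlinear_chain d (E : measurableType d) (R : realType) := NonlinearChain {
  nlmc_kernel :> probability E R -> R.-pker E ~> E ;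
  nlmc_ext : forall mu nu : probability E R, eq_law mu nu ->
    forall x : E, eq_law (nlmc_kernel mu x) (nlmc_kernel nu x) }.

Fixpoint nlmc_law d (E : measurableType d) (R : realType)
    (P : nonlinear_chain E R) (mu : probability E R) (n : nat) :
    probability E R :=
  if n is n'.+1 then
    kernel_act (P (nlmc_law P mu n')) (nlmc_law P mu n')
  else mu.

Definition invariant_measure d (E : measurableType d) (R : realType)
    (P : nonlinear_chain E R) (pi : probability E R) : Prop :=
  eq_law (kernel_act (P pi) pi) pi.

Definition condition_A d (E : measurableType d) (R : realType)
    (P : nonlinear_chain E R) (alpha : R) : Prop :=
  forall x y : E,
    ereal_sup [set d_TV (P mu x) (P nu y) |
                mu in [set: probability E R] & nu in [set: probability E R]]
    <= (2 * (1 - alpha))%:E.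

Definition condition_B d (E : measurableType d) (R : realType)
    (P : nonlinear_chain E R) (lambda : R) : Prop :=
  forall (x : E) (mu nu : probability E R),
    d_TV (P mu x) (P nu x) <= lambda%:E * d_TV mu nu.

(* Main.v *)
Require Import Defs.
From HB Require Import structures.
From mathcomp Require Import all_boot all_order all_algebra.
From mathcomp Require Import all_classical all_reals all_analysis.
From mathcomp Require Import measurable_realfun ring lra.

Set Implicit Arguments.
Unset Strict Implicit.
Unset Printing Implicit Defensive.

Import Order.TTheory GRing.Theory Num.Theory.
Import numFieldNormedType.Exports.

Local Open Scope classical_set_scope.
Local Open Scope ring_scope.
Local Open Scope ereal_scope.

(** Let [a] and [l] be the constants of conditions (A) and (B), and write [e]
    for half the distance between two laws [p] and [q], so that [0 <= e <= 1].
    Think of a coupling of [p] and [q]: with probability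
    [1 - e] both chains sit at the same point, where (B) says that their
    transition laws differ by at most [l * e]; with probability [e] they sit
    at different points, where (A) says that the transition laws differ by at
    most [1 - a].  One step of the chain therefore turns [e] into at most
      [(1 - e) * (l * e) + e * (1 - a) = e * (1 - (a - l) - l * e)]
    (lemma [tv_le_step]).  No coupling is constructed: [Rintegral_cross_le]
    obtains the same bound by duality, integrating a single function squeezed
    between the two transition probabilities.

    Iterating from [e = 1] gives a sequence [tv_rate] that bounds the distance
    between the time-[n] laws of the chain uniformly over all pairs of initial
    laws.  It decays like [(1 - (a - l)) ^+ n] if [l < a], and like
    [1 / (l * n)] if [l = a], where the recursion is [b' = b * (1 - l * b)].
    As the rate does not depend on the initial laws, the laws along one
    trajectory are Cauchy; total variation is complete ([tv_complete]) and a
    step is nonexpansive, so the limit is invariant, and the same rate yields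
    uniqueness and the two convergence bounds.

    For [a < l <= 1] all counterexamples are lazy chains on [nat]:
    [P_mu x = (1 - l) * dirac x + l * F mu].  If [F] is nonexpansive then (B)
    holds; if the range of [F] has diameter at most [(l - a) / l] then (A)
    holds; and the invariant laws are the fixed points of [F].  So it suffices
    to find nonexpansive maps of small range with several fixed points, or with
    none.  The map [cap] fixes the mass [w] of the positive integers: it
    rescales the law there when their mass exceeds [w], and adds the missing
    mass at [1] when it falls short.  It fixes every law that gives mass [w] to
    the positive integers.  Composed with a shift of the positive integers it
    has no fixed point, because the mass [w] would escape to infinity.  In the
    chain driven by [cap] alone, a trajectory started at one invariant law
    never approaches another. *)

(** * Bounds in total variation *)

(** A bound on half of [d_TV], as a predicate: bounds are composed and passed to
    the limit throughout, and the exact supremum is never needed. *)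
Definition tv_le d (E : measurableType d) (R : realType)
    (mu nu : {measure set E -> \bar R}) (c : R) : Prop :=
  forall A : set E, measurable A -> (`|fine (mu A) - fine (nu A)| <= c)%R.

Section total_variation.
Context d (E : measurableType d) (R : realType).
Implicit Types (mu nu rho : {measure set E -> \bar R}) (p q : probability E R).

Lemma fin_num_prob_measure mu A : mu setT = 1 -> measurable A ->
  mu A \is a fin_num.
Proof.
move=> mu1 mA; rewrite ge0_fin_numE// (@le_lt_trans _ _ (mu setT))//.
  by apply: le_measure; rewrite ?inE.
by rewrite mu1 ltry.
Qed.

Lemma fine_prob01 mu A : mu setT = 1 -> measurable A ->
  (0 <= fine (mu A) <= 1)%R.
Proof.
move=> mu1 mA; rewrite fine_ge0//=.
rewrite -lee_fin fineK ?fin_num_prob_measure// -mu1.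
by apply: le_measure; rewrite ?inE.
Qed.

Lemma d_TV_le mu nu c : mu setT = 1 -> nu setT = 1 ->
  d_TV mu nu <= (2 * c)%:E <-> tv_le mu nu c.
Proof.
move=> mu1 nu1; rewrite /d_TV EFinM lee_pmul2l// ?lte_fin//.
have distE A : measurable A ->
    `|mu A - nu A| = (`|fine (mu A) - fine (nu A)|%R)%:E.
  move=> mA; rewrite -{1}(@fineK _ (mu A)) ?fin_num_prob_measure//.
  by rewrite -{1}(@fineK _ (nu A)) ?fin_num_prob_measure.
split=> [le_c A mA|le_c].
  rewrite -lee_fin -distE//; apply: le_trans le_c.
  by apply: ereal_sup_ubound; exists A.
apply: ge_ereal_sup => _ [A mA <-]; rewrite distE// lee_fin; exact: le_c.
Qed.

Lemma tv_leC mu nu c : tv_le mu nu c -> tv_le nu mu c.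
Proof. by move=> h A mA; rewrite distrC; exact: h. Qed.

Lemma tv_le_trans mu nu rho b c :
  tv_le mu nu b -> tv_le nu rho c -> tv_le mu rho (b + c).
Proof.
move=> hb hc A mA; apply: (le_trans (ler_distD (fine (nu A)) _ _)).
by apply: lerD; [exact: hb | exact: hc].
Qed.

Lemma tv_leW mu nu b c : (b <= c)%R -> tv_le mu nu b -> tv_le mu nu c.
Proof. by move=> bc h A mA; rewrite (le_trans (h A mA)). Qed.

Lemma tv_le1 mu nu : mu setT = 1 -> nu setT = 1 -> tv_le mu nu 1.
Proof.
move=> mu1 nu1 A mA.
have := fine_prob01 mu1 mA; have := fine_prob01 nu1 mA.
by rewrite ler_norml; lra.
Qed.

Lemma tv_le_eq_law mu nu : eq_law mu nu -> tv_le mu nu 0.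
Proof. by move=> h A mA; rewrite h// subrr normr0. Qed.

Lemma tv_le0 mu nu : mu setT = 1 -> nu setT = 1 ->
  (forall e : R, (0 < e)%R -> tv_le mu nu e) -> eq_law mu nu.
Proof.
move=> mu1 nu1 h A mA.
rewrite -(@fineK _ (mu A)) ?fin_num_prob_measure//.
rewrite -(@fineK _ (nu A)) ?fin_num_prob_measure//; congr EFin.
apply/eqP; rewrite -subr_eq0 -normr_le0; apply/ler_addgt0Pl => e e0.
by rewrite addr0; exact: h.
Qed.

(** Passing to complements exchanges the roles of the two laws, so one sign
    suffices. *)
Lemma tv_le_one_sided p q c :
  (forall A, measurable A -> (fine (p A) - fine (q A) <= c)%R) -> tv_le p q c.
Proof.
move=> h A mA; rewrite ler_norml h// andbT.
have := h (~` A) (measurableC mA).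
rewrite !probability_setC// !fineB ?fin_num_measure//=; lra.
Qed.

End total_variation.

(** * Integrals against nearby laws *)

Section bounded_integral.
Context d (E : measurableType d) (R : realType).
Implicit Types (p q : probability E R) (f g : E -> R).

Lemma bounded_integrable p f (a b : R) : measurable_fun setT f ->
  (forall x, a <= f x <= b)%R -> p.-integrable setT (EFin \o f).
Proof.
move=> mf fab; apply: measurable_bounded_integrable => //.
  by apply: le_lt_trans (probability_le1 p measurableT) _; exact: ltry.
exists (Num.max `|a| `|b|)%R; split; first exact: num_real.
move=> M; rewrite gt_max => /andP[aM bM] x _ /=; have := fab x.
rewrite ler_norml; have := ler_norm b; have := ler_norm (- a)%R.
by rewrite normrN; lra.
Qed.

(** By the layer-cake formula the integral of [f] is that of [p (f > r)] over
    [r >= 0]; this tail changes by at most [c] when [p] is replaced by [q], and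
    vanishes for [r >= w]. *)
Lemma Rintegral_tv_le p q f (c w : R) : tv_le p q c -> (0 <= w)%R ->
  measurable_fun setT f -> (forall x, 0 <= f x <= w)%R ->
  (\int[p]_x f x - \int[q]_x f x <= w * c)%R.
Proof.
move=> pqc w0 mf fw.
have c0 : (0 <= c)%R by rewrite (le_trans _ (pqc setT _)).
pose Xp : {RV p >-> R} := mfun_Sub (mem_set mf : f \in mfun).
pose Xq : {RV q >-> R} := mfun_Sub (mem_set mf : f \in mfun).
have f0 x : (0 <= f x)%R by case/andP: (fw x).
have intE (m : probability E R) : (\int[m]_x f x)%:E = \int[m]_x (f x)%:E.
  by rewrite /Rintegral fineK// integrable_fin_num//;
     exact: bounded_integrable fw.
pose D : set (measurableTypeR R) := `[0%R, +oo[%classic.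
have ccdf_le r : D r -> ccdf Xp r <= ccdf Xq r + (c * \1_(`[0%R, w[) r)%:E.
  rewrite /D/= in_itv/= andbT => r0; rewrite indicE.
  have mA : measurable (f @^-1` `]r, +oo[%classic).
    by rewrite -[X in measurable X]setTI; apply: (mf measurableT).
  rewrite /ccdf /distribution /pushforward/=.
  have [rw|wr] := ltP r w.
    rewrite mem_set/= ?in_itv/= ?r0// mulr1.
    rewrite -(@fineK _ (p _)) ?fin_num_measure//.
    rewrite -(@fineK _ (q _)) ?fin_num_measure//.
    rewrite -EFinD lee_fin -lerBlDl (le_trans (ler_norm _))//; exact: pqc.
  rewrite memNset/= ?in_itv/= ?mulr0 ?adde0; last first.
    by apply/negP; rewrite negb_and -!leNgt wr orbT.
  rewrite [X in p X](_ : _ = set0) ?measure0//.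
  apply/seteqP; split=> x //=; rewrite in_itv/= andbT => rf.
  by have := fw x; lra.
have int_ccdf (m : probability E R) (X : {RV m >-> R}) :
    (forall x, X x = f x) ->
    (\int[m]_x f x)%:E = \int[lebesgue_measure]_(r in D) ccdf X r.
  move=> Xf; rewrite intE -ge0_expectation_ccdf => [|x]; last by rewrite Xf.
  by rewrite unlock; apply: eq_integral => x _; rewrite Xf.
rewrite lerBlDl -lee_fin EFinD (int_ccdf _ Xp)// (int_ccdf _ Xq)//.
have mD : measurable D by exact: measurable_itv.
have mccdf (m : probability E R) (X : {RV m >-> R}) :
    measurable_fun D (ccdf X : measurableTypeR R -> \bar R).
  by apply: measurable_funTS; exact: ccdf_measurable.
have mind : measurable_fun D
    (fun r : measurableTypeR R => (c * \1_(`[0%R, w[) r)%:E).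
  by apply/measurable_EFinP/measurable_funM => //; exact: measurable_indic.
apply: (@le_trans _ _ (\int[lebesgue_measure]_(r in D)
    (ccdf Xq r + (c * \1_(`[0%R, w[) r)%:E))).
  by apply: ge0_le_integral => //; exact: emeasurable_funD.
rewrite ge0_integralD//; last by move=> r _; rewrite lee_fin mulr_ge0.
apply: leeD => //.
under eq_integral do rewrite EFinM.
rewrite ge0_integralZl//; last first.
  by apply/measurable_EFinP; exact: measurable_indic.
rewrite integral_indic// mulrC EFinM lee_pmul//.
apply: (@le_trans _ _ (lebesgue_measure `[0%R, w[%classic)).
  by apply: le_measure; rewrite ?inE//=; exact: measurableI.
rewrite lebesgue_measure_itv/= lte_fin; case: ifP => // _.
by rewrite sube0.
Qed.

(** The bound that a maximal coupling of [p] and [q] would give.  It comes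
    instead from a function [h] with [f - k <= h + m <= g] whose oscillation is
    at most [w - k], so that [Rintegral_tv_le] applies to [h]. *)
Lemma Rintegral_cross_le p q f g (e c w : R) : tv_le p q e -> (e <= 1)%R ->
  measurable_fun setT f -> measurable_fun setT g ->
  (forall x, 0 <= f x <= 1)%R -> (forall x, 0 <= g x <= 1)%R ->
  (forall x y, f x - g y <= w)%R -> (forall x, f x - g x <= c)%R ->
  (\int[p]_x f x - \int[q]_x g x <= (1 - e) * c + e * w)%R.
Proof.
move=> pqe e1 mf mg f01 g01 fgw fgc.
(* If [c] exceeds [w] the hypothesis on [f x - g x] already holds with [w]. *)
pose k := Num.min c w; pose m := inf (range g).
pose h x := (Num.max (f x - k) m - m)%R.
have mg_le x : (m <= g x)%R.
  apply: ge_inf; last by exists x.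
  by exists 0%R => _ [y _ <-]; case/andP: (g01 y).
have fm x : (f x - w <= m)%R.
  apply: lb_le_inf; first by exists (g x), x.
  by move=> _ [y _ <-]; have := fgw x y; lra.
have kc : (k <= c)%R by rewrite ge_min lexx.
have kw : (k <= w)%R by rewrite ge_min lexx orbT.
have fgk x : (f x - g x <= k)%R by rewrite le_min fgc fgw.
have hw x : (0 <= h x <= w - k)%R.
  rewrite /h subr_ge0 le_max lexx orbT/= lerBlDr ge_max.
  by have := fm x; lra.
have mh : measurable_fun setT h.
  by apply: measurable_funB => //; apply: measurable_maxr => //;
     exact: measurable_funB.
have ih (r : probability E R) : r.-integrable setT (EFin \o h).
  exact: bounded_integrable hw.
have icst (r : probability E R) (a : R) : r.-integrable setT (EFin \o cst a).
  exact: finite_measure_integrable_cst.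
have ihD (r : probability E R) a :
    r.-integrable setT (EFin \o (fun x => h x + a)%R).
  by apply: (@bounded_integrable _ _ a (w - k + a)%R) => [|x];
    [exact: measurable_funD|have := hw x; lra].
have intD (r : probability E R) a :
    (\int[r]_x (h x + a) = \int[r]_x h x + a)%R.
  rewrite (@RintegralD _ _ _ r setT h (cst a)); [|by []|exact: ih|exact: icst].
  congr (_ + _)%R; have := @Rintegral_cst _ _ _ r setT measurableT a.
  by rewrite [X in fine X](_ : _ = 1) ?mulr1//; exact: probability_setT.
have pf : (\int[p]_x f x <= \int[p]_x h x + (m + k))%R.
  rewrite -intD; apply: le_Rintegral => //.
  - exact: bounded_integrable f01.
  - exact: ihD.
  move=> x _; have : (f x - k <= Num.max (f x - k) m)%R by rewrite le_max lexx.
  by rewrite /h; lra.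
have qg : (\int[q]_x h x + m <= \int[q]_x g x)%R.
  rewrite -intD; apply: le_Rintegral => //.
  - exact: ihD.
  - exact: bounded_integrable g01.
  by move=> x _; rewrite /h subrK ge_max mg_le andbT; have := fgk x; lra.
have wk0 : (0 <= w - k)%R by rewrite subr_ge0.
have := Rintegral_tv_le pqe wk0 mh hw.
have : ((1 - e) * k <= (1 - e) * c)%R by rewrite ler_wpM2l// subr_ge0.
by lra.
Qed.

End bounded_integral.

(** * Completeness and one step of the chain *)

Section kernel.
Context d (E : measurableType d) (R : realType).

Lemma fine_kernel_actE (Q : R.-pker E ~> E) (p : probability E R) B :
  measurable B ->
  fine (kernel_act Q p B) = (\int[p]_x fine (Q x B))%R.
Proof.
move=> mB; rewrite /kernel_act/= /kact /Rintegral; congr fine.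
apply: eq_integral => x _.
by rewrite fineK// fin_num_prob_measure// prob_kernel.
Qed.

Lemma tv_le_kernel_act (Q1 Q2 : R.-pker E ~> E) (p q : probability E R)
    (e c w : R) : tv_le p q e -> (e <= 1)%R ->
  (forall x y, tv_le (Q1 x) (Q2 y) w) -> (forall x, tv_le (Q1 x) (Q2 x) c) ->
  tv_le (kernel_act Q1 p) (kernel_act Q2 q) ((1 - e) * c + e * w).
Proof.
move=> pqe e1 hw hc; apply: tv_le_one_sided => A mA.
have mQ (Q : R.-pker E ~> E) : measurable_fun setT (fun x => fine (Q x A)).
  apply: measurableT_comp => //; exact: measurable_kernel.
have Q01 (Q : R.-pker E ~> E) x : (0 <= fine (Q x A) <= 1)%R.
  by apply: fine_prob01 => //; exact: prob_kernel.
rewrite !fine_kernel_actE//; apply: Rintegral_cross_le => //.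
- by move=> x y; apply: le_trans (ler_norm _) _; exact: hw.
- by move=> x; apply: le_trans (ler_norm _) _; exact: hc.
Qed.

End kernel.

Section completeness.
Context d (E : measurableType d) (R : realType).
Variables (p : nat -> probability E R) (b : nat -> R).
Hypothesis b_cvg0 : forall e : R, (0 < e)%R -> exists n, (b n <= e)%R.
Hypothesis p_cauchy : forall n k, tv_le (p n) (p (n + k)%N) (b n).

Let b_ge0 n : (0 <= b n)%R.
Proof. exact: le_trans (normr_ge0 _) (p_cauchy n 0 measurable0). Qed.

Let le0_small (x M : R) :
  (0 < M)%R -> (forall n, x <= M * b n)%R -> (x <= 0)%R.
Proof.
move=> M0 xb; apply/ler_addgt0Pl => e e0.
have [|n bn] := @b_cvg0 (e / M)%R; first by rewrite divr_gt0.
by rewrite addr0 (le_trans (xb n))// mulrC -ler_pdivlMr.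
Qed.

Let lim (A : set E) : R := inf (range (fun n => fine (p n A) + b n))%R.

(** For measurable [A] the infimum is the limit of [p n A].  It is finite and
    nonnegative on every set, measurable or not, as a measure must be. *)
Definition tv_limit (A : set E) : \bar R := (lim A)%:E.

Let tv_limit_ge0 A : 0 <= tv_limit A.
Proof.
rewrite lee_fin; apply: lb_le_inf; first by exists (fine (p 0%N A) + b 0%N)%R, 0%N.
by move=> _ [n _ <-]; rewrite addr_ge0// fine_ge0.
Qed.

Let tv_limit_near A n : measurable A ->
  (`|fine (p n A) - lim A| <= b n)%R.
Proof.
move=> mA; rewrite ler_distl; apply/andP; split; last first.
  rewrite -lerBlDr; apply: lb_le_inf.
    by exists (fine (p 0%N A) + b 0%N)%R, 0%N.
  move=> _ [m _ <-]; have := b_ge0 m; have := b_ge0 n.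
  have [nm|mn] := leqP n m.
    have := @p_cauchy n (m - n)%N _ mA; rewrite subnKC// ler_norml; lra.
  have := @p_cauchy m (n - m)%N _ mA; rewrite subnKC ?(ltnW mn)// ler_norml.
  lra.
rewrite lerBlDr; apply: ge_inf; last by exists n.
by exists 0%R => _ [m _ <-]; rewrite addr_ge0// fine_ge0.
Qed.

Let tv_limit_eq (x y : R) : (forall n, `|x - y| <= 3 * b n)%R -> x = y.
Proof.
by move=> h; apply/eqP; rewrite -subr_eq0 -normr_le0; apply: le0_small h.
Qed.

Let tv_limit0 : tv_limit set0 = 0.
Proof.
congr EFin; apply: tv_limit_eq => n.
have := tv_limit_near n measurable0; have := b_ge0 n.
by rewrite measure0/= distrC; lra.
Qed.

Let tv_limitT : tv_limit setT = 1.
Proof.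
congr EFin; apply: tv_limit_eq => n.
have := tv_limit_near n measurableT; have := b_ge0 n.
rewrite (_ : fine (p n setT) = 1%R); last by rewrite probability_setT.
by rewrite distrC; lra.
Qed.

Let tv_limitU A B : measurable A -> measurable B -> A `&` B = set0 ->
  lim (A `|` B) = (lim A + lim B)%R.
Proof.
move=> mA mB AB; apply: tv_limit_eq => n.
have := tv_limit_near n mA; have := tv_limit_near n mB.
have := tv_limit_near n (measurableU _ _ mA mB).
rewrite measureU// fineD ?fin_num_measure//.
by rewrite !ler_norml; lra.
Qed.

Let tv_limit_bigsetU (F : nat -> set E) k : (forall i, measurable (F i)) ->
  trivIset setT F ->
  lim (\big[setU/set0]_(i < k) F i) =
  (\sum_(i < k) lim (F i))%R.
Proof.
move=> mF tF; elim: k => [|k ih]; first by rewrite !big_ord0; case: tv_limit0.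
rewrite !big_ord_recr/=. rewrite tv_limitU ?ih//; last 2 first.
  exact: bigsetU_measurable.
by apply: (@trivIset_bigsetUI _ predT) => //; rewrite /predT /= trueE.
Qed.

(** Uniformity in the set is what lets the limits in [n] and in [k] be
    exchanged: each [p n] is continuous along [U k], and [p n] is within [b n] of
    the limit on all sets [U k] at once. *)
Let tv_limit_sigma_additive : semi_sigma_additive tv_limit.
Proof.
move=> F mF tF mUF.
pose U k := \big[setU/set0]_(i < k) F i.
have mU k : measurable (U k) by exact: bigsetU_measurable.
rewrite [X in X @ _ --> _](_ : _ = EFin \o (fun k => lim (U k))).
  2: by apply/funext => k /=; rewrite tv_limit_bigsetU// big_mkord sumEFin.
apply/cvg_EFin; first by near=> n.
apply/cvgrPdist_le => e e0.
have [|n bn] := @b_cvg0 (e / 3)%R; first by rewrite divr_gt0.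
have : (fun k => fine (p n (U k))) @ \oo --> fine (p n (\bigcup_k F k)).
  apply: fine_cvg; rewrite fineK ?fin_num_measure//.
  rewrite (_ : (fun k => _) = (fun k => \sum_(0 <= i < k) p n (F i))).
    exact: measure_semi_sigma_additive.
  by apply/funext => k; rewrite big_mkord -measure_semi_additive//; exact: mU.
move=> /cvgrPdist_le /(_ (e / 3)%R) []; first by rewrite divr_gt0.
move=> N _ hN; exists N => // k Nk /=.
have := hN _ Nk; have := tv_limit_near n mUF; have := tv_limit_near n (mU k).
by rewrite !ler_norml; lra.
Unshelve. all: end_near. Qed.

HB.instance Definition _ := isMeasure.Build _ _ _ tv_limit
  tv_limit0 tv_limit_ge0 tv_limit_sigma_additive.
HB.instance Definition _ := Measure_isProbability.Build _ _ _ tv_limit tv_limitT.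

(** The rate of the Cauchy condition is inherited by the limit. *)
Lemma tv_complete : exists pi : probability E R, forall n, tv_le (p n) pi (b n).
Proof. by exists tv_limit => n A mA; exact: tv_limit_near. Qed.

End completeness.

(** * Rate of convergence *)

(** The image of [e = 1], the largest possible value of half the distance, under
    [n] applications of the one-step estimate. *)
Fixpoint tv_rate (R : realType) (a l : R) (n : nat) : R :=
  if n is n'.+1 then (tv_rate a l n' * (1 - (a - l) - l * tv_rate a l n'))%R
  else 1%R.

Section rate.
Context (R : realType) (a l : R).
Hypotheses (a0 : (0 < a)%R) (a1 : (a <= 1)%R) (la : (0 <= l <= a)%R).

Lemma tv_rate01 n : (0 <= tv_rate a l n <= 1)%R.
Proof.
elim: n => [|n /andP[b0 b1]] /=; first by rewrite ler01 lexx.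
move/andP: la => [l0 l_a].
have /andP[lb0 lb1] : (0 <= l * tv_rate a l n <= l)%R.
  by rewrite mulr_ge0// ler_piMr.
have ge0 : (0 <= 1 - (a - l) - l * tv_rate a l n)%R. by move: a1; lra.
by rewrite mulr_ge0// mulr_ile1//; lra.
Qed.

Lemma tv_rate_geometric n : (tv_rate a l n <= (1 - (a - l)) ^+ n)%R.
Proof.
elim: n => [|n ih]; first by rewrite expr0.
have /andP[b0 b1] := tv_rate01 n.
move/andP: la => [l0 l_a].
have /andP[lb0 lb1] : (0 <= l * tv_rate a l n <= l)%R.
  by rewrite mulr_ge0// ler_piMr.
by rewrite exprSr /= ler_pM//; move: a1; lra.
Qed.

(** With [y = l * b] and [n * y <= 1] the next value is
    [(n + 1) * y * (1 - y) <= (1 - y) + y * (1 - y) = 1 - y ^+ 2 <= 1]. *)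
Lemma tv_rate_harmonic n : l = a -> (l * n%:R * tv_rate a l n <= 1)%R.
Proof.
move=> l_a; elim: n => [|n ih]; first by rewrite mulr0 mul0r.
have /andP[] := tv_rate01 n.
move: ih; rewrite /= -l_a -natr1; set b := tv_rate l l n => ih b0 b1.
have l0 : (0 <= l)%R by case/andP: la.
have l1 : (l <= 1)%R by rewrite l_a.
have /andP[lb0 lb1] : (0 <= l * b <= 1)%R by rewrite mulr_ge0 ?mulr_ile1.
have : (l * n%:R * b * (1 - l * b) <= 1 * (1 - l * b))%R.
  by rewrite ler_wpM2r//; lra.
have : (0 <= (l * b) * (l * b))%R by exact: sqr_ge0.
by nra.
Qed.

Lemma tv_rate_cvg0 (e : R) : (0 < e)%R -> exists n, (tv_rate a l n <= e)%R.
Proof.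
move=> e0; have [l_a|al] := ltP l a.
  have r1 : (`|1 - (a - l)| < 1)%R by rewrite ger0_norm; move: a1 la; lra.
  have /cvgrPdist_le /(_ _ e0) [N _ hN] := cvg_expr r1.
  exists N; apply: le_trans (tv_rate_geometric N) _.
  have := hN N (leqnn _); rewrite sub0r normrN => h.
  exact: le_trans (ler_norm _) h.
have l_a : l = a by move: la; lra.
have l0 : (0 < l)%R by rewrite l_a.
pose n := (Num.truncn (l * e)^-1).+1; exists n.
have nle : (1 <= l * e * n%:R)%R.
  rewrite -ler_pdivrMl ?mulr_gt0// mulr1 ltW//.
  exact: truncnS_gt.
have n0 : (0 < l * n%:R)%R by rewrite mulr_gt0// ltr0n.
rewrite -(ler_pM2l n0) (le_trans (tv_rate_harmonic n l_a))//.
by rewrite mulrAC.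
Qed.

End rate.

(** * Existence, uniqueness and convergence *)

Section law_congruence.
Context d (E : measurableType d) (R : realType) (X : nonlinear_chain E R).
Implicit Types p q : probability E R.

Lemma eq_law_step p q : eq_law p q ->
  eq_law (kernel_act (X p) p) (kernel_act (X q) q).
Proof.
move=> pq; apply: tv_le0; try exact: probability_setT.
move=> e e0; apply: tv_leW (ltW e0) _.
have := @tv_le_kernel_act _ _ _ (X p) (X q) p q 0 0 1 (tv_le_eq_law pq) ler01.
rewrite mulr0 mul0r addr0; apply => [x y|x].
  by apply: tv_le1; exact: prob_kernel.
exact/tv_le_eq_law/nlmc_ext.
Qed.

Lemma eq_law_invariant p n : invariant_measure X p -> eq_law (nlmc_law X p n) p.
Proof.
move=> pinv; elim: n => [|n ih] //= A mA.
by rewrite -(pinv A mA) (eq_law_step ih mA).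
Qed.

End law_congruence.

Section convergence.
Context d (E : measurableType d) (R : realType) (X : nonlinear_chain E R).
Variables (a l : R).
Hypotheses (a0 : (0 < a)%R) (la : (0 <= l <= a)%R).
Hypotheses (XA : condition_A X a) (XB : condition_B X l).
Implicit Types p q : probability E R.

Lemma condition_A_tv_le p q x y : tv_le (X p x) (X q y) (1 - a).
Proof.
apply/d_TV_le; [exact: prob_kernel|exact: prob_kernel|].
apply: le_trans (XA x y); apply: ereal_sup_ubound.
by exists p => //; exists q.
Qed.

Lemma condition_B_tv_le p q (e : R) x :
  tv_le p q e -> tv_le (X p x) (X q x) (l * e).
Proof.
move=> /d_TV_le pqe; apply/d_TV_le; [exact: prob_kernel|exact: prob_kernel|].
apply: le_trans (XB x p q) _.
rewrite [leRHS](_ : _ = l%:E * (2 * e)%:E); last first.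
  by rewrite -EFinM; congr EFin; ring.
case/andP: la => l0 _.
by apply: lee_wpmul2l; rewrite ?lee_fin// pqe//; exact: probability_setT.
Qed.

(** A measurable type is inhabited, and (A) at a single point bounds a distance,
    which is nonnegative. *)
Let a1 : (a <= 1)%R.
Proof.
have := condition_A_tv_le (dirac point) (dirac point) point point measurable0.
by rewrite !measure0 subrr normr0 subr_ge0.
Qed.

(** The contraction estimate.  Its quadratic term [l * e ^+ 2] drives the
    convergence when [l = a]. *)
Lemma tv_le_step p q (e : R) : tv_le p q e -> (e <= 1)%R ->
  tv_le (kernel_act (X p) p) (kernel_act (X q) q) (e * (1 - (a - l) - l * e)).
Proof.
move=> pqe e1.
rewrite (_ : (_ * _)%R = (1 - e) * (l * e) + e * (1 - a))%R; last by ring.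
apply: tv_le_kernel_act => // [x y|x]; first exact: condition_A_tv_le.
exact: condition_B_tv_le.
Qed.

Lemma tv_le_law p q n :
  tv_le (nlmc_law X p n) (nlmc_law X q n) (tv_rate a l n).
Proof.
elim: n => [|n ih] /=; first by apply: tv_le1; exact: probability_setT.
by apply: tv_le_step => //; case/andP: (tv_rate01 a1 la n).
Qed.

Lemma nlmc_lawD p n k :
  nlmc_law X p (n + k)%N = nlmc_law X (nlmc_law X p k) n.
Proof. by elim: n => //= n ->. Qed.

(** The laws along any one trajectory are Cauchy, since [nlmc_law X p0 (n + k)]
    is the time-[n] law started from [nlmc_law X p0 k]. *)
Lemma invariant_measure_exists : exists pi, invariant_measure X pi.
Proof.
pose p0 : probability E R := dirac point.
have [|n k|pi hpi] := @tv_complete _ E R (nlmc_law X p0) (tv_rate a l).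
- exact: tv_rate_cvg0.
- by rewrite nlmc_lawD; exact: tv_le_law.
exists pi; apply: tv_le0; try exact: probability_setT.
move=> e e0.
have [|n hn] := tv_rate_cvg0 a0 a1 la (e := e / 2)%R; first by rewrite divr_gt0.
have /andP[b0 b1] := tv_rate01 a1 la n.
have lb : (0 <= l * tv_rate a l n)%R by rewrite mulr_ge0//; case/andP: la.
have := tv_le_trans (tv_le_step (tv_leC (hpi n)) b1) (hpi n.+1).
apply: tv_leW; rewrite /=.
have : (tv_rate a l n * (1 - (a - l) - l * tv_rate a l n) <= tv_rate a l n)%R.
  by rewrite ler_piMr//; move: la; lra.
lra.
Qed.

Lemma tv_le_law_invariant p pi n : invariant_measure X pi ->
  tv_le (nlmc_law X p n) pi (tv_rate a l n).
Proof.
move=> pinv; rewrite -[tv_rate a l n]addr0.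
apply: tv_le_trans (tv_le_law p pi n) _.
exact/tv_le_eq_law/eq_law_invariant.
Qed.

Lemma invariant_measure_unique p q :
  invariant_measure X p -> invariant_measure X q -> eq_law p q.
Proof.
move=> pinv qinv; apply: tv_le0; try exact: probability_setT.
move=> e e0; have [n hn] := tv_rate_cvg0 a0 a1 la e0.
apply: tv_leW hn _; rewrite -[tv_rate a l n]add0r.
apply: tv_le_trans (tv_le_law_invariant p n qinv).
by apply/tv_leC/tv_le_eq_law/eq_law_invariant.
Qed.

Lemma ergodicity : exists pi : probability E R,
      [/\ invariant_measure X pi,
          forall pi' : probability E R,
            invariant_measure X pi' -> eq_law pi' pi,
          (l < a)%R ->
            forall (mu : probability E R) (n : nat),
              d_TV (nlmc_law X mu n) pi <= (2 * (1 - (a - l)) ^+ n)%:E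
        & l = a ->
            forall (mu : probability E R) (n : nat),
              d_TV (nlmc_law X mu n) pi
                <= (if n == 0%N then +oo else (2 / (l * n%:R))%:E)].
Proof.
have [pi pinv] := invariant_measure_exists; exists pi; split => //.
- by move=> q qinv; exact: invariant_measure_unique.
- move=> _ p n; apply/d_TV_le; try exact: probability_setT.
  apply: tv_leW (tv_rate_geometric a1 la n) _; exact: tv_le_law_invariant.
- move=> l_a p [|n]; first by rewrite eqxx leey.
  apply/d_TV_le; try exact: probability_setT.
  apply: tv_leW (tv_le_law_invariant p n.+1 pinv).
  have n0 : (0 < l * n.+1%:R)%R by rewrite mulr_gt0 ?ltr0n// l_a.
  by rewrite -div1r ler_pdivlMr// mulrC; exact: tv_rate_harmonic.
Qed.

End convergence.

(** * Lazy chains *)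

Lemma d_TV_fin d (E : measurableType d) (R : realType) (p q : probability E R) :
  exists e : R, d_TV p q = (2 * e)%:E.
Proof.
have le2 : d_TV p q <= (2 * 1)%:E.
  by apply/d_TV_le; try apply: tv_le1; exact: probability_setT.
have ge0 : 0 <= d_TV p q.
  rewrite /d_TV mule_ge0// (@le_trans _ _ `|p set0 - q set0|)//.
  apply: ereal_sup_ubound; exists set0 => //=; exact: measurable0.
exists (fine (d_TV p q) / 2)%R; rewrite mulrC divfK// fineK//.
by rewrite ge0_fin_numE// (le_lt_trans le2)// ltry.
Qed.

Section mixture.
Context d (E : measurableType d) (R : realType).
Variables (t : {i01 R}) (p q : probability E R).

Definition mixture : set E -> \bar R :=
  measure_add (mscale ((1 - t%:num)%:nng)%R p) (mscale ((t%:num)%:nng)%R q).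

HB.instance Definition _ := Measure.on mixture.

Lemma mixtureE A : mixture A = (1 - t%:num)%R%:E * p A + t%:num%:E * q A.
Proof. by rewrite /mixture measure_addE. Qed.

Let mixture_setT : mixture setT = 1.
Proof.
by rewrite mixtureE !probability_setT !mule1 -EFinD subrK.
Qed.

HB.instance Definition _ :=
  Measure_isProbability.Build _ _ _ mixture mixture_setT.

Lemma fine_mixtureE A : measurable A ->
  fine (mixture A) = ((1 - t%:num) * fine (p A) + t%:num * fine (q A))%R.
Proof.
move=> mA; rewrite mixtureE -(@fineK _ (p A)) ?fin_num_measure//.
by rewrite -(@fineK _ (q A)) ?fin_num_measure.
Qed.

End mixture.

Section lazy_kernel.
Context d (E : measurableType d) (R : realType).
Variables (t : {i01 R}) (q : probability E R).

Definition lazy_kernel (x : E) : {measure set E -> \bar R} :=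
  mixture t (dirac x) q.

Let measurable_lazy_kernel U : measurable U ->
  measurable_fun [set: E] (lazy_kernel ^~ U).
Proof.
move=> mU; rewrite /lazy_kernel /=.
under eq_fun do rewrite mixtureE.
apply: emeasurable_funD => //; apply: measurable_funeM.
rewrite (_ : (fun x => _) = EFin \o \1_U).
  by apply/measurable_EFinP; exact: measurable_indic.
by apply/funext => x /=; rewrite indicE.
Qed.

HB.instance Definition _ :=
  isKernel.Build _ _ _ _ _ lazy_kernel measurable_lazy_kernel.

Let lazy_kernel_setT x : lazy_kernel x setT = 1.
Proof. exact: probability_setT. Qed.

HB.instance Definition _ :=
  Kernel_isProbability.Build _ _ _ _ _ lazy_kernel lazy_kernel_setT.

Lemma fine_kernel_act_lazy (p : probability E R) A : measurable A ->
  fine (kernel_act lazy_kernel p A) =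
  ((1 - t%:num) * fine (p A) + t%:num * fine (q A))%R.
Proof.
move=> mA.
have diracA : (fun x : E => dirac x A : \bar R) = EFin \o \1_A.
  by apply/funext => x /=; rewrite indicE.
have mdirac : measurable_fun setT (fun x : E => dirac x A : \bar R).
  by rewrite diracA; apply/measurable_EFinP; exact: measurable_indic.
rewrite /kernel_act/= /kact /=.
under eq_integral do rewrite mixtureE.
rewrite ge0_integralD//; last 3 first.
- by move=> x _; rewrite mule_ge0.
- exact: measurable_funeM.
- by move=> x _; rewrite mule_ge0.
rewrite ge0_integralZl//.
have -> : \int[p]_x dirac x A = p A.
  under eq_integral do rewrite -[dirac _ _]/(
    (fun x : E => dirac x A : \bar R) _) diracA.
  by rewrite integral_indic// setIT.
have -> : \int[p]_x (t%:num%:E * q A) = t%:num%:E * q A.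
  rewrite integral_cst// [X in _ * X](_ : _ = 1) ?mule1//.
  exact: probability_setT.
by rewrite fineD ?fineM ?fin_numM ?fin_num_measure.
Qed.
End lazy_kernel.

Lemma prob_fine_inj d (E : measurableType d) (R : realType)
    (p q : probability E R) A : measurable A ->
  fine (p A) = fine (q A) -> p A = q A.
Proof.
move=> mA pq; rewrite -(@fineK _ (p A)) ?fin_num_measure// pq.
by rewrite fineK ?fin_num_measure.
Qed.

Lemma tv_le_mixture d (E : measurableType d) (R : realType) (t : {i01 R})
    (p p' q q' : probability E R) (a b : R) :
  tv_le p p' a -> tv_le q q' b ->
  tv_le (mixture t p q) (mixture t p' q') ((1 - t%:num) * a + t%:num * b).
Proof.
move=> pa qb A mA; rewrite !fine_mixtureE// opprD addrACA -!mulrBr.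
apply: le_trans (ler_normD _ _) _; rewrite !normrM.
rewrite [`|1 - t%:num|%R]ger0_norm// [`|t%:num|%R]ger0_norm//.
by apply: lerD; rewrite ler_wpM2l//; [exact: pa|exact: qb].
Qed.

Section lazy_chain.
Context d (E : measurableType d) (R : realType).
Variables (t : {i01 R}) (F : probability E R -> probability E R).
Hypothesis F_nonexpansive : forall (p q : probability E R) (c : R),
  tv_le p q c -> tv_le (F p) (F q) c.

Let lazy_chain_ext (p q : probability E R) : eq_law p q ->
  forall x, eq_law (lazy_kernel t (F p) x) (lazy_kernel t (F q) x).
Proof.
move=> pq x A mA; rewrite /lazy_kernel/= !mixtureE; congr (_ + _ * _).
apply: tv_le0 mA; try exact: probability_setT.
by move=> e e0; apply: tv_leW (ltW e0) _; exact/F_nonexpansive/tv_le_eq_law.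
Qed.

(** A chain that stays put with probability [1 - t] and otherwise jumps to a
    point drawn from [F mu], whatever its position.  Questions about the chain
    become questions about the map [F]. *)
Definition lazy_chain : nonlinear_chain E R :=
  @NonlinearChain _ E R (fun p => lazy_kernel t (F p)) lazy_chain_ext.

Lemma lazy_chain_invariant p : (0 < t%:num)%R ->
  invariant_measure lazy_chain p <-> eq_law (F p) p.
Proof.
move=> t0.
have fineE A : measurable A -> fine (kernel_act (lazy_chain p) p A) =
    ((1 - t%:num) * fine (p A) + t%:num * fine (F p A))%R.
  by move=> mA; exact: fine_kernel_act_lazy.
split=> h A mA; apply: (prob_fine_inj mA).
  by apply: (mulfI (lt0r_neq0 t0)); have := fineE _ mA; rewrite (h A mA); lra.
by rewrite fineE// (h A mA); lra.
Qed.

Lemma lazy_chain_condition_A (w : R) : (forall p q, tv_le (F p) (F q) w) ->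
  condition_A lazy_chain (t%:num * (1 - w)).
Proof.
move=> Fw x y; apply: ge_ereal_sup => _ [p _ [q _ <-]].
apply/d_TV_le; try exact: prob_kernel.
rewrite (_ : 1 - _ = (1 - t%:num) * 1 + t%:num * w)%R; last by ring.
by apply: tv_le_mixture => //; apply: tv_le1; exact: probability_setT.
Qed.

Lemma lazy_chain_condition_B : condition_B lazy_chain t%:num.
Proof.
move=> x p q; have [e pqe] := d_TV_fin p q.
rewrite pqe -EFinM mulrCA; apply/d_TV_le; try exact: prob_kernel.
rewrite -[X in tv_le _ _ X]add0r -[X in tv_le _ _ (X + _)](mulr0 (1 - t%:num)%R).
apply: tv_le_mixture; first exact: tv_le_eq_law.
apply: F_nonexpansive; apply/d_TV_le; try exact: probability_setT.
by rewrite pqe.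
Qed.

End lazy_chain.

(** The trajectory from [q] stays at [q], at a fixed positive distance from
    [p]. *)
Lemma law_not_cvg d (E : measurableType d) (R : realType)
    (X : nonlinear_chain E R) (p q : probability E R) :
  invariant_measure X q -> ~ eq_law p q ->
  ~ (d_TV (nlmc_law X q n) p @[n --> \oo] --> 0).
Proof.
move=> qinv pq cv; apply: pq; apply: tv_le0; try exact: probability_setT.
move=> e e0.
have : \forall n \near \oo, d_TV (nlmc_law X q n) p < (2 * e)%:E.
  move/fine_cvgP : cv => [_ /cvgrPdist_lt /(_ _ (mulr_gt0 (ltr0Sn R 1) e0))].
  apply: filterS => n /=; have [c ->] := d_TV_fin (nlmc_law X q n) p.
  by rewrite sub0r normrN lte_fin /=; apply: le_lt_trans; exact: ler_norm.
move=> [n _ /(_ n (leqnn _))] /ltW h.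
rewrite -[e]addr0; apply: (@tv_le_trans _ _ _ _ (nlmc_law X q n)).
  by apply/tv_leC/d_TV_le => //; exact: probability_setT.
exact/tv_le_eq_law/eq_law_invariant.
Qed.

(** * Maps of laws on the natural numbers *)

Section capping.
Context (R : realType) (w : R).
Hypotheses (w0 : (0 < w)%R) (w1 : (w <= 1)%R).
Implicit Types p q : probability nat R.

Let pos : set nat := [set n | (0 < n)%N].
Let mpos : measurable pos. Proof. by []. Qed.

Definition cap_factor p : R := (w / Num.max (fine (p pos)) w)%R.

Let max_gt0 p : (0 < Num.max (fine (p pos)) w)%R.
Proof. by rewrite lt_max w0 orbT. Qed.

Lemma cap_factor_ge0 p : (0 <= cap_factor p)%R.
Proof. by rewrite divr_ge0// ltW. Qed.

Lemma cap_factor_le1 p : (cap_factor p <= 1)%R.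
Proof. by rewrite ler_pdivrMr// mul1r le_max lexx orbT. Qed.

Lemma cap_factor_mass p : (cap_factor p * fine (p pos) <= w)%R.
Proof.
rewrite mulrAC ler_pdivrMr// ler_pM2l//.
by rewrite le_max lexx.
Qed.

Let gap_ge0 p : (0 <= w - cap_factor p * fine (p pos))%R.
Proof. by rewrite subr_ge0 cap_factor_mass. Qed.

Let ow_ge0 : (0 <= 1 - w)%R. Proof. by rewrite subr_ge0. Qed.

(** Mass [1 - w] sits at [0]; the part of [p] on the positive integers is scaled
    down to mass at most [w]; what is missing to [w] is put at [1]. *)
Definition cap p : set nat -> \bar R :=
  measure_add
    (measure_add (mscale (NngNum ow_ge0) (dirac 0%N))
                 (mscale (NngNum (gap_ge0 p)) (dirac 1%N)))
    (mscale (NngNum (cap_factor_ge0 p)) (mrestr p mpos)).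

HB.instance Definition _ p := Measure.on (cap p).

Let capE p A : cap p A = (1 - w)%R%:E * dirac 0%N A +
  (w - cap_factor p * fine (p pos))%R%:E * dirac 1%N A +
  (cap_factor p)%:E * p (A `&` pos).
Proof. by rewrite /cap measure_addE [X in X + _]measure_addE. Qed.

Let cap_setT p : cap p setT = 1.
Proof.
rewrite capE !diracT !mule1 setTI -(@fineK _ (p pos)) ?fin_num_measure//.
by rewrite -EFinM -!EFinD; congr EFin; ring.
Qed.

HB.instance Definition _ p :=
  Measure_isProbability.Build _ _ _ (cap p) (cap_setT p).

Lemma fine_capE p A : fine (cap p A) = ((1 - w) * \1_A 0%N +
  (w - cap_factor p * fine (p pos)) * \1_A 1%N +
  cap_factor p * fine (p (A `&` pos)))%R.
Proof.
rewrite capE -(@fineK _ (p (A `&` pos))) ?fin_num_measure//.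
Qed.

Let cap_factor_anti p q : (fine (q pos) <= fine (p pos))%R ->
  (cap_factor p <= cap_factor q)%R.
Proof.
move=> qp; rewrite ler_wpM2l// ?(ltW w0)// lef_pV2 ?posrE//.
by rewrite ge_max !le_max qp lexx orbT.
Qed.

Let cap_mass_mono p q : (fine (q pos) <= fine (p pos))%R ->
  (cap_factor q * fine (q pos) <= cap_factor p * fine (p pos))%R.
Proof.
move=> qp; rewrite /cap_factor.
have q0 : (0 <= fine (q pos))%R by rewrite fine_ge0.
have [pw|wp] := leP (fine (p pos)) w.
  have qw := le_trans qp pw.
  by rewrite !max_r// divff ?lt0r_neq0// !mul1r.
rewrite divfK ?lt0r_neq0 ?(lt_trans w0)//.
exact: cap_factor_mass.
Qed.

(** Let [p] be the law with more mass on the positive integers.  Then [cap p]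
    has the smaller scaling factor and the smaller correction at [1], so
    [cap p - cap q] is at most a factor in [0, 1] times [p - q] restricted to the
    positive integers. *)
Lemma cap_tv_le p q c : tv_le p q c -> tv_le (cap p) (cap q) c.
Proof.
wlog qp : p q / (fine (q pos) <= fine (p pos))%R.
  move=> h pqc; have [|/ltW] := leP (fine (q pos)) (fine (p pos)).
    by move=> /h; exact.
  by move=> /h; move/(_ (tv_leC pqc))/tv_leC.
move=> pqc; apply: tv_le_one_sided => A _; rewrite !fine_capE.
have c0 : (0 <= c)%R by exact: le_trans (normr_ge0 _) (pqc set0 measurable0).
have i0 : (0 <= \1_A 1%N :> R)%R by [].
have q0 : (0 <= fine (q (A `&` pos)))%R by rewrite fine_ge0.
have /(ler_wpM2r i0) := cap_mass_mono qp.
have /(ler_wpM2r q0) := cap_factor_anti qp.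
have /(ler_wpM2r c0) := cap_factor_le1 p.
have mA : measurable (A `&` pos) by [].
have /(ler_wpM2l (cap_factor_ge0 p)) := le_trans (ler_norm _) (pqc _ mA).
lra.
Qed.

(** All values of [cap] share the mass [1 - w] at [0]. *)
Lemma cap_diameter p q : tv_le (cap p) (cap q) w.
Proof.
apply: tv_le_one_sided => A _; rewrite !fine_capE.
have q0 : (0 <= cap_factor q * fine (q (A `&` pos)))%R.
  by rewrite mulr_ge0 ?cap_factor_ge0 ?fine_ge0.
have pA : (fine (p (A `&` pos)) <= fine (p pos))%R.
  by rewrite fine_le ?fin_num_measure// le_measure ?inE//; exact: subIsetr.
have := ler_wpM2l (cap_factor_ge0 p) pA.
have i1 : (\1_A 1%N <= 1 :> R)%R by rewrite indicE lern1; case: (_ \in _).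
have i0 : (0 <= \1_A 1%N :> R)%R by [].
have := ler_wpM2l (gap_ge0 p) i1.
have := mulr_ge0 (gap_ge0 q) i0.
lra.
Qed.

Lemma cap_mass p : fine (cap p pos) = w.
Proof.
rewrite fine_capE setIid !indicE [0%N \in pos]memNset// [1%N \in pos]mem_set//.
by rewrite mulr0 mulr1 add0r subrK.
Qed.

Let cap_factor1 p : fine (p pos) = w -> cap_factor p = 1%R.
Proof. by move=> pw; rewrite /cap_factor pw maxxx divff// lt0r_neq0. Qed.

Lemma fine_cap_mass p A : fine (p pos) = w ->
  fine (cap p A) = ((1 - w) * \1_A 0%N + fine (p (A `&` pos)))%R.
Proof.
move=> pw; rewrite fine_capE (cap_factor1 pw) pw.
by rewrite !mul1r subrr mul0r addr0.
Qed.

(** [cap] leaves alone the laws with mass [w] on the positive integers; the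
    two-point ones already provide several fixed points. *)
Lemma cap_two_point (t : {i01 R}) k : t%:num = w ->
  eq_law (cap (mixture t (dirac 0%N) (dirac k.+1)))
         (mixture t (dirac 0%N) (dirac k.+1)).
Proof.
move=> tw A _; apply: prob_fine_inj => //.
have mA B : fine (mixture t (dirac 0%N) (dirac k.+1) B) =
    ((1 - w) * \1_B 0%N + w * \1_B k.+1)%R.
  by rewrite fine_mixtureE//= tw.
rewrite fine_cap_mass !mA.
  rewrite !indicE !in_setI [0%N \in pos]memNset// [k.+1 \in pos]mem_set//.
  by rewrite andbF andbT mulr0 add0r.
rewrite !indicE [0%N \in pos]memNset// [k.+1 \in pos]mem_set//.
by rewrite mulr0 add0r mulr1.
Qed.

Definition shift_pos (n : nat) : nat := if n is n'.+1 then n'.+2 else 0%N.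

Let measurable_shift_pos : measurable_fun setT shift_pos. Proof. by []. Qed.

Definition shift_law p : probability nat R :=
  distribution p (mfun_Sub (mem_set measurable_shift_pos : shift_pos \in mfun)).

Let shift_lawE p A : shift_law p A = p (shift_pos @^-1` A). Proof. by []. Qed.

Lemma shift_law_tv_le p q c :
  tv_le p q c -> tv_le (shift_law p) (shift_law q) c.
Proof. by move=> h A mA; exact: (h (shift_pos @^-1` A)). Qed.

(** A fixed point has mass [w] on the positive integers, where [cap] then acts as
    the identity.  So it is invariant under the shift there: the mass at [1] is
    zero, hence the mass at every later point, which contradicts [0 < w]. *)
Lemma cap_shift_no_fixpoint p : ~ eq_law (cap (shift_law p)) p.
Proof.
move=> fixp.
have pw : fine (p pos) = w by rewrite -(fixp pos)// cap_mass.
have sw : fine (shift_law p pos) = w.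
  rewrite shift_lawE -pw; congr (fine (p _)).
  by apply/seteqP; split=> -[].
have pE n : fine (p [set n.+1]) = fine (p (shift_pos @^-1` [set n.+1])).
  rewrite -(fixp [set n.+1])// fine_cap_mass// indicE memNset//.
  rewrite mulr0 add0r. rewrite shift_lawE; congr (fine (p _)).
  by apply/seteqP; split=> -[|m]//= [].
have p0 n : fine (p [set n.+1]) = 0%R.
  elim: n => [|n ih]; rewrite pE.
    rewrite (_ : _ @^-1` _ = set0) ?measure0//.
    by apply/seteqP; split=> -[|m].
  rewrite -[RHS]ih; congr (fine (p _)).
  by apply/seteqP; split=> -[|m]//= [->].
have : p pos = 0.
  apply: (@measure_negligible _ _ _ p) => //.
  rewrite (_ : pos = \bigcup_n [set n.+1]); last first.
    by apply/seteqP; split=> [[|n]//= _|_ [n _ ->]//]; exists n.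
  apply: negligible_bigcup => n; apply/negligibleP => //.
  have : p [set n.+1] = 0 by rewrite -[LHS]fineK ?fin_num_measure// p0.
  exact.
move=> ppos; move: pw w0; rewrite ppos /= => <-; by rewrite ltxx.
Qed.

End capping.

(** * Counterexamples for [a < l] *)

Section counterexamples.
Context (R : realType) (a l : R).
Hypotheses (a0 : (0 < a)%R) (al : (a < l)%R) (l1 : (l <= 1)%R).

(** The diameter for which [1 - l * (1 - w)], the contribution of laziness
    included, is the bound [1 - a] of condition (A) with [t = l]. *)
Let w : R := ((l - a) / l)%R.
Let l0 : (0 < l)%R. Proof. exact: lt_trans al. Qed.
Let w0 : (0 < w)%R. Proof. by rewrite divr_gt0// subr_gt0. Qed.
Let w1 : (w <= 1)%R. Proof. by rewrite ler_pdivrMr// mul1r gerBl ltW. Qed.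

Let t : {i01 R} := Itv01 (ltW l0) l1.

Let condition_A_lazy (F : probability nat R -> probability nat R)
    (hF : forall (p q : probability nat R) c, tv_le p q c -> tv_le (F p) (F q) c) :
  (forall p q : probability nat R, tv_le (F p) (F q) w) ->
  condition_A (@lazy_chain _ nat R t F hF) a.
Proof.
move=> /(lazy_chain_condition_A t hF).
rewrite [X in condition_A _ X](_ : _ = a)//.
by rewrite /w /=; field; exact: lt0r_neq0.
Qed.

(** Every law with mass [w] on the positive integers is invariant for this
    chain. *)
Definition frozen_chain := lazy_chain t (cap_tv_le w0 w1).

Definition shift_chain :=
  lazy_chain t (fun p q c h => cap_tv_le w0 w1 (shift_law_tv_le h)).


Lemma frozen_chain_A : condition_A frozen_chain a.
Proof. by apply: condition_A_lazy => p q; exact: cap_diameter. Qed.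

Lemma frozen_chain_B : condition_B frozen_chain l.
Proof. exact: (lazy_chain_condition_B t (cap_tv_le w0 w1)). Qed.

Lemma shift_chain_A : condition_A shift_chain a.
Proof. by apply: condition_A_lazy => p q; exact: cap_diameter. Qed.

Lemma shift_chain_B : condition_B shift_chain l.
Proof.
exact: (lazy_chain_condition_B t
  (fun p q c h => cap_tv_le w0 w1 (shift_law_tv_le h))).
Qed.

Lemma frozen_chain_two_invariant : exists p q : probability nat R,
  [/\ invariant_measure frozen_chain p, invariant_measure frozen_chain q &
      ~ eq_law p q].
Proof.
pose u : {i01 R} := Itv01 (ltW w0) w1.
pose pi k : probability nat R := mixture u (dirac 0%N) (dirac k.+1).
exists (pi 0%N), (pi 1%N); split.
- by apply/lazy_chain_invariant => //; exact: cap_two_point.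
- by apply/lazy_chain_invariant => //; exact: cap_two_point.
move=> /(_ [set 1%N] I) /(congr1 fine).
rewrite !fine_mixtureE//= !indicE.
rewrite [0%N \in _]memNset// [1%N \in _]mem_set// [2%N \in _]memNset//.
by rewrite !mulr0 !add0r mulr1 => w_eq0; move: w0; rewrite w_eq0 ltxx.
Qed.

Lemma shift_chain_no_invariant p : ~ invariant_measure shift_chain p.
Proof.
by move/lazy_chain_invariant => /(_ l0); exact: cap_shift_no_fixpoint.
Qed.

End counterexamples.

Theorem theorem2p2 (R : realType) :
  (forall (d : measure_display) (E : measurableType d)
      (X : nonlinear_chain E R) (alpha lambda : R),
    (0 < alpha)%R -> condition_A X alpha ->
    (0 <= lambda <= alpha)%R -> condition_B X lambda ->
    exists pi : probability E R,
      [/\ invariant_measure X pi,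
          forall pi' : probability E R,
            invariant_measure X pi' -> eq_law pi' pi,
          (lambda < alpha)%R ->
            forall (mu : probability E R) (n : nat),
              d_TV (nlmc_law X mu n) pi
                <= (2 * (1 - (alpha - lambda)) ^+ n)%:E
        & lambda = alpha ->
            forall (mu : probability E R) (n : nat),
              d_TV (nlmc_law X mu n) pi
                <= (if n == 0%N then +oo else (2 / (lambda * n%:R))%:E)])
  /\
  (forall alpha lambda : R,
    (0 < alpha)%R -> (alpha < lambda)%R -> (lambda <= 1)%R ->
    [/\ exists (d : measure_display) (E : measurableType d)
            (X : nonlinear_chain E R),
          [/\ condition_A X alpha, condition_B X lambda
            & exists pi1 pi2 : probability E R,
                [/\ invariant_measure X pi1, invariant_measure X pi2
                  & ~ eq_law pi1 pi2]],
        exists (d : measure_display) (E : measurableType d)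
            (Y : nonlinear_chain E R),
          [/\ condition_A Y alpha, condition_B Y lambda
            & forall pi : probability E R, ~ invariant_measure Y pi]
      & exists (d : measure_display) (E : measurableType d)
            (Z : nonlinear_chain E R),
          [/\ condition_A Z alpha, condition_B Z lambda
            & exists pi : probability E R,
                invariant_measure Z pi /\
                exists mu : probability E R,
                  ~ (d_TV (nlmc_law Z mu n) pi @[n --> \oo] --> 0)]]).
Proof.
split=> [d E X alpha lambda a0 XA la XB|alpha lambda a0 al l1].
  exact: ergodicity.
have [p [q [pinv qinv pq]]] := frozen_chain_two_invariant a0 al l1.
split.
- exists default_measure_display, nat, (frozen_chain a0 al l1); split.
  + exact: frozen_chain_A.
  + exact: frozen_chain_B.
  + by exists p, q.
- exists default_measure_display, nat, (shift_chain a0 al l1); split.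
  + exact: shift_chain_A.
  + exact: shift_chain_B.
  + exact: shift_chain_no_invariant.
- exists default_measure_display, nat, (frozen_chain a0 al l1); split.
  + exact: frozen_chain_A.
  + exact: frozen_chain_B.
  + exists p; split => //; exists q; exact: law_not_cvg.
Qed.
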